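(* There are precisely four subalgebras of $\mathfrak{so}(4,\mathbb{C})$ isomorphic to $K_1$, the abelian Lie algebra of dimension $2$, up to inner automorphism. They are $$K_1^1=\langle x_1,x_2\rangle,\quad K_1^2=\langle x_1,h_2\rangle,\quad K_1^3=\langle h_1,x_2\rangle,\quad K_1^4=\langle h_1,h_2\rangle.$$ That is, every $2$-dimensional abelian subalgebra of $\mathfrak{so}(4,\mathbb{C})$ is equivalent to exactly one of these four subalgebras.
   Context: $\mathfrak{so}(4,\mathbb{C})\cong\mathfrak{sl}(2,\mathbb{C})\oplus\mathfrak{sl}(2,\mathbb{C})$ is realized as the Lie algebra of $4\times4$ complex block diagonal matrices with two traceless $2\times 2$ diagonal blocks. With $E_{ij}$ the $4\times 4$ matrix units, its Chevalley basis is $x_1=E_{12}$, $y_1=E_{21}$, $h_1=E_{11}-E_{22}$, $x_2=E_{34}$, $y_2=E_{43}$, $h_2=E_{33}-E_{44}$. The notation $\langle\cdots\rangle$ denotes complex linear span. The inner automorphisms of $\mathfrak{so}(4,\mathbb{C})$ are the maps $X\mapsto AXA^{-1}$ with $A\in SL(2,\mathbb{C})\times SL(2,\mathbb{C})$ (block diagonal $4\times4$ matrices with both $2\times2$ blocks of determinant $1$). Two subalgebras $S,S'$ are equivalent (up to inner automorphism), written $S\sim S'$, if $\psi(S)=S'$ for some inner automorphism $\psi$ of $\mathfrak{so}(4,\mathbb{C})$. *)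

(* Defs.v *)
From HB Require Import structures.
From mathcomp Require Import all_boot all_order all_algebra.
From mathcomp Require Import complex reals.

Set Implicit Arguments.
Unset Strict Implicit.
Unset Printing Implicit Defensive.

Import GRing.Theory.
Local Open Scope ring_scope.

(** The complex numbers are [R[i]] for [R : realType]; [realType] is
    characterized up to isomorphism as the field of real numbers. *)

Section So4.
Variable R : realType.
Local Notation C := R[i].

Definition block_diag (A B : 'M[C]_2) : 'M[C]_4 :=
  block_mx A 0 0 B : 'M[C]_(2 + 2).

(** [so(4,C)], realized as [sl(2,C) + sl(2,C)] in block diagonal form. *)
Definition so4 (X : 'M[C]_4) : Prop :=
  exists A B : 'M[C]_2, [/\ \tr A = 0, \tr B = 0 & X = block_diag A B].

(** Ordinals are 0-based: [E_ij] is [delta_mx (i - 1) (j - 1)]. *)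
Definition x1 : 'M[C]_4 := delta_mx 0 1.
Definition h1 : 'M[C]_4 := delta_mx 0 0 - delta_mx 1 1.
Definition x2 : 'M[C]_4 := delta_mx 2 3.
Definition h2 : 'M[C]_4 := delta_mx 2 2 - delta_mx 3 3.

Definition lie (X Y : 'M[C]_4) : 'M[C]_4 := X *m Y - Y *m X.

Definition subalgebra (S : {vspace 'M[C]_4}) : Prop :=
  (forall X, X \in S -> so4 X) /\
  (forall X Y, X \in S -> Y \in S -> lie X Y \in S).

Definition abelian_subalgebra (S : {vspace 'M[C]_4}) : Prop :=
  subalgebra S /\ (forall X Y, X \in S -> Y \in S -> lie X Y = 0).

Definition SL2xSL2 (A : 'M[C]_4) : Prop :=
  exists A1 A2 : 'M[C]_2, [/\ \det A1 = 1, \det A2 = 1 & A = block_diag A1 A2].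

(** Conjugation by [A], as an endomorphism of the ambient matrix space; when
    [SL2xSL2 A] holds its restriction to [so4] is an inner automorphism. *)
Definition conj_by (A : 'M[C]_4) : 'End('M[C]_4) :=
  linfun (mulmxr (invmx A) \o mulmx A).

Lemma conj_byE A X : conj_by A X = A *m X *m invmx A.
Proof. by rewrite lfunE. Qed.

Definition inner_equiv (S S' : {vspace 'M[C]_4}) : Prop :=
  exists2 A, SL2xSL2 A & (conj_by A @: S)%VS = S'.

(** [K1rep i] is the representative [K_1^(i+1)]. *)
Definition K1rep (i : 'I_4) : {vspace 'M[C]_4} :=
  tnth [tuple <<[:: x1; x2]>>%VS; <<[:: x1; h2]>>%VS;
              <<[:: h1; x2]>>%VS; <<[:: h1; h2]>>%VS] i.

End So4.

(* Main.v *)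
Require Import Defs.
From HB Require Import structures.
From mathcomp Require Import all_boot all_order all_algebra.
From mathcomp Require Import complex boolp reals.
From mathcomp Require Import ring.

Set Implicit Arguments.
Unset Strict Implicit.
Unset Printing Implicit Defensive.

Import GRing.Theory Num.Theory.
Local Open Scope ring_scope.

(** Two commuting traceless 2x2 matrices are proportional, so each projection of
    an abelian subalgebra [S] to a factor sl(2) is at most a line; when
    [\dim S = 2] this forces [S] to be the sum of a line [<a>] in the first
    factor and a line [<b>] in the second. Since [C] is algebraically closed, a
    nonzero traceless 2x2 matrix is SL(2)-conjugate to a nonzero multiple of
    [E_12] (nilpotent case) or of [E_11 - E_22]. The representatives are told
    apart by whether the determinant of the upper left, respectively of the
    lower right, block vanishes on the whole subalgebra, and this is invariant
    under conjugation. *)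

(** * Entrywise computation with 2x2 matrices *)

Lemma mx2_eq (T : Type) (A B : 'M[T]_2) :
  A 0 0 = B 0 0 -> A 0 1 = B 0 1 -> A 1 0 = B 1 0 -> A 1 1 = B 1 1 -> A = B.
Proof.
move=> e00 e01 e10 e11; apply/matrixP => i j.
have E (k : 'I_2) : k = 0 \/ k = 1.
  by case: k => [[|[|//]] ?]; [left|right]; apply/val_inj.
by case: (E i) => ->; case: (E j) => ->.
Qed.

Lemma mulmx2E (F : pzSemiRingType) (A B : 'M[F]_2) i j :
  (A *m B) i j = A i 0 * B 0 j + A i 1 * B 1 j.
Proof.
by rewrite mxE !big_ord_recl big_ord0 addr0; congr (_ + _ * _); congr (_ _ _);
  apply/val_inj.
Qed.

Lemma mxtrace2_eq0 (F : pzRingType) (A : 'M[F]_2) : \tr A = 0 -> A 1 1 = - A 0 0.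
Proof.
rewrite /mxtrace !big_ord_recl big_ord0 addr0.
rewrite (_ : lift _ _ = 1); last exact/val_inj.
by move/(canRL (addKr _)); rewrite addr0.
Qed.

Lemma mx2_eq0_traceless (F : pzRingType) (A : 'M[F]_2) :
  \tr A = 0 -> A 0 0 = 0 -> A 0 1 = 0 -> A 1 0 = 0 -> A = 0.
Proof.
by move=> /mxtrace2_eq0 e11 e00 e01 e10; apply: mx2_eq; rewrite ?e11 ?e00 ?mxE ?oppr0.
Qed.

(** * Commuting traceless 2x2 matrices *)

(** Lets [ring] exploit a known equation [a = b]: only the identity [x - y = a - b] is left to
    check. *)
Lemma eq_from_sub (V : zmodType) (x y a b : V) : a = b -> x - y = a - b -> x = y.
Proof. by move=> ->; rewrite subrr; apply: subr0_eq. Qed.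

(** The equations say that the cross product of the two vectors vanishes; dividing by a nonzero
    coordinate of the first gives the factor. *)
Lemma parallel3 (F : fieldType) (p q r p' q' r' : F) :
  p * q' = p' * q -> p * r' = p' * r -> q * r' = q' * r ->
  [\/ p != 0, q != 0 | r != 0] ->
  exists s, [/\ p' = s * p, q' = s * q & r' = s * r].
Proof.
move=> pq pr qr.
have proportional (a x y z : F) : a != 0 -> a * x = y * z -> x = y / a * z.
  by move=> a_neq0 e; rewrite mulrAC -e mulrC mulKf.
case=> nz; [exists (p' / p)|exists (q' / q)|exists (r' / r)]; split;
  by apply: proportional => //; first [exact: mulrC | done | rewrite mulrC -(pq, pr, qr) mulrC].
Qed.

Lemma traceless_comm_colinear (F : fieldType) (A B : 'M[F]_2) :
  (2%:R : F) != 0 -> A != 0 -> \tr A = 0 -> \tr B = 0 ->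
  A *m B = B *m A -> exists s, B = s *: A.
Proof.
move=> two_neq0 A_neq0 trA trB /matrixP AB.
have a11 := mxtrace2_eq0 trA; have b11 := mxtrace2_eq0 trB.
have nz : [\/ A 0 0 != 0, A 0 1 != 0 | A 1 0 != 0].
  have [a00|?] := eqVneq (A 0 0) 0; last by constructor 1.
  have [a01|?] := eqVneq (A 0 1) 0; last by constructor 2.
  have [a10|?] := eqVneq (A 1 0) 0; last by constructor 3.
  by case/eqP: A_neq0; apply: mx2_eq0_traceless.
have [s [e00 e01 e10]] : exists s, [/\ B 0 0 = s * A 0 0,
    B 0 1 = s * A 0 1 & B 1 0 = s * A 1 0].
  (* In the coordinates [(p, q, r)] the entries of the commutator are the cross product, up to sign;
     the two off-diagonal entries carry a factor 2, which is cancelled. *)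
  have := AB 1 0; have := AB 0 1; have := AB 0 0; rewrite !mulmx2E a11 b11.
  move: (A 0 0) (A 0 1) (A 1 0) (B 0 0) (B 0 1) (B 1 0) nz => p q r p' q' r'.
  move=> nz e00 e01 e10; apply: parallel3 nz.
  - by apply: (mulfI two_neq0); apply: (eq_from_sub e01); ring.
  - by apply: (mulfI two_neq0); apply/esym/(eq_from_sub e10); ring.
  - by apply: (eq_from_sub e00); ring.
by exists s; apply: mx2_eq; rewrite !mxE ?a11 ?b11 ?mulrN ?e00.
Qed.

(** * Normal form of a traceless 2x2 matrix under SL(2) *)

Lemma det_mx2 (F : comPzRingType) (A : 'M[F]_2) :
  \det A = A 0 0 * A 1 1 - A 0 1 * A 1 0.
Proof.
rewrite (expand_det_row _ 0) !big_ord_recl big_ord0 addr0 /cofactor !det_mx11 !mxE.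
rewrite expr0 mul1r expr1 mulN1r mulrN.
by congr (_ * _ - _ * _); congr (_ _ _); apply/val_inj.
Qed.

Definition mx2 (F : Type) (p q r s : F) : 'M[F]_2 :=
  \matrix_(i, j) if i == 0 then if j == 0 then p else q
                 else if j == 0 then r else s.

(** A Boolean chooses the normal form, so that a pair of Booleans encodes the four
    representatives. *)
Definition sl2rep (F : pzRingType) (nilp : bool) : 'M[F]_2 :=
  if nilp then delta_mx 0 1 else delta_mx 0 0 - delta_mx 1 1.

(** The intertwining form [P *m A = c *: (sl2rep F b *m P)] avoids computing the inverse of [P]. *)
Lemma traceless_normal_form (F : numClosedFieldType) (A : 'M[F]_2) :
  A != 0 -> \tr A = 0 ->
  exists P c b, [/\ \det P = 1, c != 0 & P *m A = c *: (sl2rep F b *m P)].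
Proof.
move=> A_neq0 trA; have a11 := mxtrace2_eq0 trA.
(* The rows (p, q) and (r, s) of [P] are left eigenvectors of [A], or a Jordan
   chain when [A] is nilpotent, rescaled to give determinant 1. *)
have crit (c : F) b (p q r s : F) : c != 0 -> p * s - q * r = 1 ->
    (let a00 := A 0 0 in let a01 := A 0 1 in let a10 := A 1 0 in
     let u0 := if b then r else p in let u1 := if b then s else q in
     let v0 := if b then 0 else - r in let v1 := if b then 0 else - s in
     [/\ p * a00 + q * a10 = c * u0, p * a01 - q * a00 = c * u1,
         r * a00 + s * a10 = c * v0 & r * a01 - s * a00 = c * v1]) ->
  exists P c b, [/\ \det P = 1, c != 0 & P *m A = c *: (sl2rep F b *m P)].
  move=> c_neq0 detP /= [e00 e01 e10 e11]; exists (mx2 p q r s), c, b; split => //.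
    by rewrite det_mx2 !mxE.
  apply: mx2_eq; rewrite mulmx2E ?a11 [RHS]mxE mulmx2E !mxE /= ?mulrN ?e00 ?e01 ?e10 ?e11;
    by case: (b); rewrite !mxE /=; ring.
have [a10|a10] := eqVneq (A 1 0) 0; last first.
  (* [l ^+ 2] is [- \det A], so the eigenvalues of [A] are [l] and [- l]. *)
  pose l := sqrtC (A 0 0 ^+ 2 + A 0 1 * A 1 0).
  have l2 : l ^+ 2 = A 0 0 ^+ 2 + A 0 1 * A 1 0 by rewrite sqrtCK.
  have a01 : A 0 1 = (l ^+ 2 - A 0 0 ^+ 2) / A 1 0.
    by rewrite l2 addrC addKr mulfK.
  have [l0|l_neq0] := eqVneq l 0.
    (* The second row spans the left kernel; the first row times [A] is [- A 1 0] times the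
       second. *)
    apply: (crit (- A 1 0) true 0 1 (-1) (A 0 0 / A 1 0)).
    - by rewrite oppr_eq0.
    - by ring.
    - by rewrite /= a01 l0; split; field.
  (* The rows are the left eigenvectors [(A 1 0, l - A 0 0)] and [(A 1 0, - l - A 0 0)], the first
     divided by their determinant [- 2 * l * A 1 0]. *)
  apply: (crit l false (- (2 * l)^-1) (- (l - A 0 0) / (2 * l * A 1 0))
    (A 1 0) (- l - A 0 0)) => //.
    by field; rewrite ?a10 ?l_neq0.
  by rewrite /= a01; split; field; rewrite ?a10 ?l_neq0.
(* Now [A] is upper triangular, with its eigenvalues on the diagonal. *)
have [a00|a00] := eqVneq (A 0 0) 0; last first.
  apply: (crit (A 0 0) false 1 (A 0 1 / (2 * A 0 0)) 0 1) => //; first by ring.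
  by rewrite /= a10; split; field; rewrite ?a00.
have [a01|a01] := eqVneq (A 0 1) 0.
  by case/eqP: A_neq0; apply: mx2_eq0_traceless.
(* Here [A] is already [A 0 1] times [E_12], and [P] is the identity. *)
apply: (crit (A 0 1) true 1 0 0 1) => //; first by ring.
by rewrite /= a10 a00; split; ring.
Qed.

(** * Block diagonal matrices and conjugation *)

Section So4.
Variable R : realType.
Local Notation C := R[i].
Implicit Types (A B a b : 'M[C]_2) (X Y P : 'M[C]_4) (S : {vspace 'M[C]_4}).

Definition ul (X : 'M[C]_4) : 'M[C]_2 := @ulsubmx C 2 2 2 2 X.
Definition dr (X : 'M[C]_4) : 'M[C]_2 := @drsubmx C 2 2 2 2 X.

Lemma ul_block_diag A B : ul (block_diag A B) = A.
Proof. exact: block_mxKul. Qed.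

Lemma dr_block_diag A B : dr (block_diag A B) = B.
Proof. exact: block_mxKdr. Qed.

Lemma block_diagD A B A' B' :
  block_diag A B + block_diag A' B' = block_diag (A + A') (B + B').
Proof.
(* The size 4 is recast as 2 + 2 by conversion, so that the block lemmas apply. *)
rewrite -[LHS]/((block_mx A 0 0 B : 'M_(2 + 2)) + block_mx A' 0 0 B').
by rewrite add_block_mx !addr0.
Qed.

Lemma block_diagZ (s : C) A B : s *: block_diag A B = block_diag (s *: A) (s *: B).
Proof.
rewrite -[LHS]/(s *: (block_mx A 0 0 B : 'M_(2 + 2))).
by rewrite scale_block_mx !scaler0.
Qed.

Lemma block_diagM A B A' B' :
  block_diag A B *m block_diag A' B' = block_diag (A *m A') (B *m B').
Proof.
rewrite -[LHS]/((block_mx A 0 0 B : 'M_(2 + 2)) *m block_mx A' 0 0 B').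
by rewrite mulmx_block !mulmx0 !mul0mx !addr0 !add0r.
Qed.

Lemma block_diag_inj A B A' B' :
  block_diag A B = block_diag A' B' -> A = A' /\ B = B'.
Proof.
move=> e; rewrite -(ul_block_diag A B) -{2}(dr_block_diag A B) e.
by rewrite ul_block_diag dr_block_diag.
Qed.

Lemma det_block_diag A B : \det (block_diag A B) = \det A * \det B.
Proof. exact: (@det_ublock C 2 2 A 0 B). Qed.

Lemma SL2xSL2_unit P : SL2xSL2 P -> P \in unitmx.
Proof.
by move=> [A [B [dA dB ->]]]; rewrite unitmxE det_block_diag dA dB mulr1 unitr1.
Qed.

Lemma conj_by_eq P X Y : P \in unitmx -> P *m X = Y *m P -> conj_by P X = Y.
Proof. by move=> uP e; rewrite conj_byE e mulmxK. Qed.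

(** For arbitrary [X], its off-diagonal blocks meet only zero blocks in the diagonal blocks of these
    products. *)
Lemma mul_ul_dr A B X :
  (ul (block_diag A B *m X) = A *m ul X) * (dr (block_diag A B *m X) = B *m dr X) *
  (ul (X *m block_diag A B) = ul X *m A) * (dr (X *m block_diag A B) = dr X *m B).
Proof.
pose Y : 'M[C]_(2 + 2) := X; pose D : 'M[C]_(2 + 2) := block_mx A 0 0 B.
suff: (ulsubmx (D *m Y) = A *m ulsubmx Y) * (drsubmx (D *m Y) = B *m drsubmx Y) *
      (ulsubmx (Y *m D) = ulsubmx Y *m A) * (drsubmx (Y *m D) = drsubmx Y *m B) by [].
rewrite -[Y]submxK /D !mulmx_block !block_mxKul !block_mxKdr.
by rewrite !mulmx0 !mul0mx !addr0 !add0r.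
Qed.

(** Taking determinants of the diagonal blocks in [Y *m P = P *m X] suffices, since both blocks of
    [P] have determinant 1. *)
Lemma det_conj_by P X : SL2xSL2 P ->
  \det (ul (conj_by P X)) = \det (ul X) /\ \det (dr (conj_by P X)) = \det (dr X).
Proof.
move=> sP; have uP := SL2xSL2_unit sP; move: sP => [A [B [dA dB eP]]].
have e : conj_by P X *m P = P *m X by rewrite conj_byE mulmxKV.
move: (conj_by P X) e => Y; rewrite eP => e; split.
  by have := congr1 (fun Z => \det (ul Z)) e; rewrite !mul_ul_dr !det_mulmx dA mulr1 mul1r.
by have := congr1 (fun Z => \det (dr Z)) e; rewrite !mul_ul_dr !det_mulmx dB mulr1 mul1r.
Qed.

(** * Sums of a line in each factor *)

Definition plane a b : {vspace 'M[C]_4} :=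
  <<[:: block_diag a 0; block_diag 0 b]>>%VS.

Lemma mem_plane a b X :
  reflect (exists s t, X = block_diag (s *: a) (t *: b)) (X \in plane a b).
Proof.
apply: (iffP idP); rewrite /plane span_cons span_seq1.
  move=> /memv_addP[_ /vlineP[s ->] [_ /vlineP[t ->] ->]]; exists s, t.
  by rewrite !block_diagZ block_diagD !scaler0 addr0 add0r.
move=> [s [t ->]]; apply/memv_addP; exists (s *: block_diag a 0).
  exact/memvZ/memv_line.
exists (t *: block_diag 0 b); first exact/memvZ/memv_line.
by rewrite !block_diagZ block_diagD !scaler0 addr0 add0r.
Qed.

Lemma plane_abelian a b : \tr a = 0 -> \tr b = 0 -> abelian_subalgebra (plane a b).
Proof.
move=> tra trb.
have comm X Y : X \in plane a b -> Y \in plane a b -> lie X Y = 0.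
  move=> /mem_plane[s [t ->]] /mem_plane[s' [t' ->]]; apply/eqP.
  rewrite subr_eq0 !block_diagM -!scalemxAl -!scalemxAr !scalerA.
  by rewrite [s * _]mulrC [t * _]mulrC.
do 2?split => //.
  move=> _ /mem_plane[s [t ->]]; exists (s *: a), (t *: b).
  by rewrite !mxtraceZ tra trb !mulr0.
by move=> X Y SX SY; rewrite comm ?mem0v.
Qed.

Lemma dim_plane a b : a != 0 -> b != 0 -> \dim (plane a b) = 2%N.
Proof.
(* The dimension equals the number of generators exactly when they are free. *)
move=> a_neq0 b_neq0; apply/eqP; rewrite -[2%N]/(size [:: block_diag a 0; block_diag 0 b]).
rewrite -/(free _) free_cons seq1_free span_seq1; apply/andP; split.
  apply/vlineP => -[k]; rewrite block_diagZ => /block_diag_inj[].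
  by rewrite scaler0 => a0; rewrite a0 eqxx in a_neq0.
apply: contra b_neq0 => /eqP b0; apply/eqP.
by rewrite -[b](dr_block_diag 0) b0 /dr; apply/matrixP => i j; rewrite !mxE.
Qed.

(** Conjugation sends each generator to a nonzero multiple of the corresponding target generator,
    which spans the same line. *)
Lemma conj_by_plane A B a b a' b' (c d : C) :
  \det A = 1 -> \det B = 1 -> c != 0 -> d != 0 ->
  A *m a = c *: (a' *m A) -> B *m b = d *: (b' *m B) ->
  inner_equiv (plane a b) (plane a' b').
Proof.
move=> dA dB c0 d0 eA eB; exists (block_diag A B); first by exists A, B.
have uP : block_diag A B \in unitmx by apply: SL2xSL2_unit; exists A, B.
rewrite /plane limg_span /= !span_cons span_nil !addv0.
rewrite (conj_by_eq (Y := c *: block_diag a' 0) uP); last first.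
  by rewrite block_diagZ !block_diagM eA mulmx0 scaler0 mul0mx scalemxAl.
rewrite (conj_by_eq (Y := d *: block_diag 0 b') uP); last first.
  by rewrite block_diagZ !block_diagM eB mulmx0 scaler0 mul0mx scalemxAl.
have lineZ (k : C) X : k != 0 -> <[k *: X]>%VS = <[X]>%VS.
  move=> k0; apply/eqP; rewrite eqEsubv -!memvE; apply/andP; split.
    exact/memvZ/memv_line.
  by apply/vlineP; exists k^-1; rewrite scalerA mulVf ?scale1r.
by rewrite !lineZ.
Qed.

(** * Abelian subalgebras of dimension 2 *)

(** Meant for [f] equal to [ul] or [dr]: any nonzero value of [f] on [S] spans a line containing all
    the others. *)
Lemma projection_line (f : 'M[C]_4 -> 'M[C]_2) S :
  (forall X, X \in S -> \tr (f X) = 0) ->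
  (forall X Y, X \in S -> Y \in S -> f X *m f Y = f Y *m f X) ->
  exists a, [/\ a != 0, \tr a = 0 & forall X, X \in S -> exists s, f X = s *: a].
Proof.
move=> trf commf; have two_neq0 : (2%:R : C) != 0 by rewrite pnatr_eq0.
have [[X SX fX]|f0] := pselect (exists2 X, X \in S & f X != 0); last first.
  (* When [f] vanishes on [S], any nonzero traceless matrix will do; [E_12] is the default. *)
  exists (delta_mx 0 1); split.
  - by apply/eqP => /matrixP/(_ 0 1); rewrite !mxE => /eqP; rewrite oner_eq0.
  - by rewrite /mxtrace !big_ord_recl big_ord0 !mxE !addr0.
  - move=> X SX; exists 0; rewrite scale0r; apply/eqP/negPn/negP => fX.
    by apply: f0; exists X.
exists (f X); split => // [|Y SY]; first exact: trf.
by apply: traceless_comm_colinear => //; [exact: trf | exact: trf | exact: commf].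
Qed.

Lemma abelian_is_plane S : abelian_subalgebra S -> \dim S = 2%N ->
  exists a b, [/\ a != 0, b != 0, \tr a = 0, \tr b = 0 & S = plane a b].
Proof.
move=> [[so4S _] commS] dimS.
have comm2 X Y : X \in S -> Y \in S ->
    ul X *m ul Y = ul Y *m ul X /\ dr X *m dr Y = dr Y *m dr X.
  move=> SX SY; have /subr0_eq := commS _ _ SX SY.
  have [A [B [_ _ ->]]] := so4S _ SX; have [A' [B' [_ _ ->]]] := so4S _ SY.
  by rewrite !block_diagM !ul_block_diag !dr_block_diag => /block_diag_inj.
have [||a [a0 tra Sa]] := @projection_line ul S.
- by move=> X /so4S[A [B [? _ ->]]]; rewrite ul_block_diag.
- by move=> X Y SX SY; have [] := comm2 _ _ SX SY.
have [||b [b0 trb Sb]] := @projection_line dr S.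
- by move=> X /so4S[A [B [_ ? ->]]]; rewrite dr_block_diag.
- by move=> X Y SX SY; have [] := comm2 _ _ SX SY.
(* Both spaces have dimension 2, so inclusion of [S] in the plane gives equality. *)
exists a, b; split => //; apply/eqP; rewrite eqEdim dimS dim_plane // andbT.
apply/subvP => X SX; apply/mem_plane.
have [s es] := Sa _ SX; have [t et] := Sb _ SX; exists s, t.
rewrite -es -et; have [A [B [_ _ ->]]] := so4S _ SX.
by rewrite ul_block_diag dr_block_diag.
Qed.

(** * The four representatives in block form *)

Lemma delta_block_ul (j k : 'I_2) :
  delta_mx (lshift 2 j) (lshift 2 k) = block_diag (delta_mx j k : 'M[C]_2) 0.
Proof. by rewrite delta_mx_ushift delta_mx_lshift /block_diag /block_mx row_mx0. Qed.

Lemma delta_block_dr (j k : 'I_2) :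
  delta_mx (rshift 2 j) (rshift 2 k) = block_diag 0 (delta_mx j k : 'M[C]_2).
Proof. by rewrite delta_mx_dshift delta_mx_rshift /block_diag /block_mx row_mx0. Qed.

Lemma block_diagB A B A' B' :
  block_diag A B - block_diag A' B' = block_diag (A - A') (B - B').
Proof. by rewrite -[- block_diag _ _]scaleN1r block_diagZ block_diagD !scaleN1r. Qed.

Lemma x1_block : x1 R = block_diag (sl2rep C true) 0.
Proof.
by rewrite -delta_block_ul; congr delta_mx; apply/val_inj.
Qed.

Lemma x2_block : x2 R = block_diag 0 (sl2rep C true).
Proof.
by rewrite -delta_block_dr; congr delta_mx; apply/val_inj.
Qed.

Lemma h1_block : h1 R = block_diag (sl2rep C false) 0.
Proof.
rewrite -[X in block_diag _ X](subrr 0) -block_diagB -!delta_block_ul.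
by congr (delta_mx _ _ - delta_mx _ _); apply/val_inj.
Qed.

Lemma h2_block : h2 R = block_diag 0 (sl2rep C false).
Proof.
rewrite -[X in block_diag X _](subrr 0) -block_diagB -!delta_block_dr.
by congr (delta_mx _ _ - delta_mx _ _); apply/val_inj.
Qed.

(** The 0-based index is read as two bits: [i < 2] puts [E_12] in the first factor, [i] even puts it
    in the second. *)
Lemma K1rep_plane (i : 'I_4) :
  K1rep R i = plane (sl2rep C (i < 2)%N) (sl2rep C (~~ odd i)).
Proof.
rewrite /K1rep (tnth_nth 0%VS) x1_block x2_block h1_block h2_block.
by case: i => [[|[|[|[|//]]]] ?].
Qed.

Lemma sl2rep_traceless (b : bool) : \tr (sl2rep C b) = 0.
Proof.
case: b; rewrite /mxtrace !big_ord_recl big_ord0 !mxE /= !addr0 // ?addr0.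
by rewrite subr0 sub0r subrr.
Qed.

Lemma det_sl2rep (b : bool) : \det (sl2rep C b) = (~~ b)%:R * -1.
Proof. by case: b; rewrite det_mx2 !mxE /=; ring. Qed.

Lemma sl2rep_neq0 (b : bool) : sl2rep C b != 0.
Proof.
apply/eqP; case: b.
  by move=> /matrixP/(_ 0 1); rewrite !mxE => /eqP; rewrite oner_eq0.
by move=> /matrixP/(_ 0 0); rewrite !mxE subr0 => /eqP; rewrite oner_eq0.
Qed.

(** * Invariants separating the representatives *)

(* On traceless 2x2 matrices, zero determinant means nilpotent. *)
Definition nilpotent_ul S : Prop := forall X, X \in S -> \det (ul X) = 0.
Definition nilpotent_dr S : Prop := forall X, X \in S -> \det (dr X) = 0.

Lemma inner_equiv_nilpotent S S' : inner_equiv S S' ->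
  (nilpotent_ul S <-> nilpotent_ul S') /\ (nilpotent_dr S <-> nilpotent_dr S').
Proof.
move=> [P sP <-]; have inv X := det_conj_by X sP.
split; split=> nS X.
- by move=> /memv_imgP[Y SY ->]; rewrite (inv Y).1; apply: nS.
- by move=> SX; rewrite -(inv X).1; apply/nS/memv_img.
- by move=> /memv_imgP[Y SY ->]; rewrite (inv Y).2; apply: nS.
- by move=> SX; rewrite -(inv X).2; apply/nS/memv_img.
Qed.

Lemma K1rep_nilpotent (i : 'I_4) :
  (nilpotent_ul (K1rep R i) <-> (i < 2)%N) /\
  (nilpotent_dr (K1rep R i) <-> ~~ odd i).
Proof.
have nz : - 1 != 0 :> C by rewrite oppr_eq0 oner_eq0.
have memK s t : block_diag (s *: sl2rep C (i < 2)%N) (t *: sl2rep C (~~ odd i)) \in K1rep R i.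
  by rewrite K1rep_plane; apply/mem_plane; exists s, t.
split; split.
(* The first generator is the test element: its block has determinant -1 in the diagonal case. *)
- move=> /(_ _ (memK 1 0)); rewrite ul_block_diag scale1r det_sl2rep.
  by case: (_ < _)%N => //= /eqP; rewrite mul1r (negPf nz).
- move=> i2 X; rewrite K1rep_plane => /mem_plane[s [t ->]].
  by rewrite ul_block_diag detZ det_sl2rep i2 mul0r mulr0.
- move=> /(_ _ (memK 0 1)); rewrite dr_block_diag scale1r det_sl2rep.
  by case: (odd i) => //= /eqP; rewrite mul1r (negPf nz).
- move=> i2 X; rewrite K1rep_plane => /mem_plane[s [t ->]].
  by rewrite dr_block_diag detZ det_sl2rep i2 mul0r mulr0.
Qed.

Lemma K1rep_index_inj (i j : 'I_4) : (i < 2)%N = (j < 2)%N -> odd i = odd j -> i = j.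
Proof.
by move: i j => [[|[|[|[|//]]]] ?] [[|[|[|[|//]]]] ?] // _ _; apply/val_inj.
Qed.

Lemma K1rep_index (b c : bool) : exists i : 'I_4, (i < 2)%N = b /\ ~~ odd i = c.
Proof.
by case: b; case: c; [exists 0|exists 1|exists 2|exists 3].
Qed.

End So4.

Theorem theorem5p2 (R : realType) :
  (forall i : 'I_4, abelian_subalgebra (K1rep R i) /\ \dim (K1rep R i) = 2%N) /\
  (forall S : {vspace 'M[R[i]]_4},
     abelian_subalgebra S -> \dim S = 2%N ->
     exists! i : 'I_4, inner_equiv S (K1rep R i)).
Proof.
split=> [i|S abS dimS].
  rewrite K1rep_plane; split; first by apply: plane_abelian; apply: sl2rep_traceless.
  by apply: dim_plane; apply: sl2rep_neq0.
have [a [b [a0 b0 tra trb eS]]] := abelian_is_plane abS dimS.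
have [P [c [m [dP c0 eP]]]] := traceless_normal_form a0 tra.
have [Q [d [n [dQ d0 eQ]]]] := traceless_normal_form b0 trb.
(* The types [m] and [n] of the two normal forms are the bits of the index. *)
have [i [im i_n]] := K1rep_index m n.
have SKi : inner_equiv S (K1rep R i).
  rewrite eS K1rep_plane im i_n; exact: conj_by_plane dP dQ c0 d0 eP eQ.
exists i; split => // j SKj.
(* Uniqueness: nilpotency of each block passes through [S] from one representative to the other, so
   both bits of [i] and [j] agree. *)
have [ul_i dr_i] := inner_equiv_nilpotent SKi.
have [ul_j dr_j] := inner_equiv_nilpotent SKj.
have [nul_i ndr_i] := K1rep_nilpotent R i.
have [nul_j ndr_j] := K1rep_nilpotent R j.
apply: K1rep_index_inj; first by apply/idP/idP; tauto.
by apply: negb_inj; apply/idP/idP; tauto.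
Qed.
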